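(* Let $G=(V,E,\mu,\kappa)$ be a finite connected undirected graph with positive vertex masses $\mu$ and positive edge conductances $\kappa$, and let $S$ be a proper nonempty subset of $V$. Let $\lambda(G,S)$ be the Dirichlet eigenvalue and $H(G,S)$ the Hardy quantity of $G$ with boundary set $S$. Then $$\frac{1}{4H}\le \lambda\le \frac{1}{H}.$$
   Context: Let $L$ be the Laplacian of $G$, with quadratic form $x^\top Lx=\sum_{(u,v)\in E}\kappa_{(u,v)}(x_u-x_v)^2$, and let $M=\mathrm{diag}(\mu)$ be the diagonal mass matrix. The Dirichlet eigenvalue is $\lambda(G,S)=\min\{\frac{x^\top Lx}{x^\top Mx} : x\in\mathbb{R}^V,\ x|_S=0,\ x\neq 0\}$. For $A\subseteq V$, $\mu(A)=\sum_{v\in A}\mu_v$. For disjoint nonempty $A,B\subseteq V$, the effective resistance $R(A,B)$ is defined by $\frac{1}{R(A,B)}=\min\{x^\top Lx : x\in\mathbb{R}^V,\ x|_A=1,\ x|_B=0\}$. The Hardy quantity is $H(G,S)=\max\{R(S,A)\mu(A) : A\subseteq V,\ A\neq\emptyset,\ A\cap S=\emptyset\}$. *)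

(* Defs.v *)
From HB Require Import structures.
From mathcomp Require Import all_boot all_order all_algebra.
From mathcomp Require Import mathcomp_extra boolp classical_sets reals.
From mathcomp Require Import ring.

Set Implicit Arguments.
Unset Strict Implicit.
Unset Printing Implicit Defensive.

Import Order.TTheory GRing.Theory Num.Theory.

Local Open Scope ring_scope.

(* [edge] is the symmetric relation of the undirected edge set, so the values
   of [cond] off [edge] are irrelevant.  Loops are allowed; they contribute
   nothing to the Laplacian below. *)
Record wgraph (R : realType) (V : finType) := WGraph {
  edge : rel V;
  mass : V -> R;
  cond : V -> V -> R;
  edge_sym : symmetric edge;
  mass_gt0 : forall v, 0 < mass v;
  cond_sym : forall u v, edge u v -> cond u v = cond v u;
  cond_gt0 : forall u v, edge u v -> 0 < cond u v }.

(* The minimum of a set of reals, with junk value 0 when none is attained. *)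
Definition minimum (R : realType) (E : set R) : R :=
  xget 0 [set m | E m /\ lbound E m]%classic.

Lemma minimumE (R : realType) (E : set R) (m : R) :
  E m -> lbound E m -> minimum E = m.
Proof.
move=> Em mlb; apply: xget_unique => [//|m' [Em' m'lb]].
by apply/le_anti; rewrite (m'lb _ Em) (mlb _ Em').
Qed.

Section Graph.
Variables (R : realType) (V : finType) (G : wgraph R V).

Definition graph_connected : Prop := forall u v : V, connect (edge G) u v.

(* Matrices and vectors indexed by V use the enumeration of V. *)
Definition vcoord (x : 'cV[R]_#|V|) (v : V) : R := x (enum_rank v) 0.

Definition wadj (u v : V) : R := if edge G u v then cond G u v else 0.

Definition laplacian : 'M[R]_#|V| :=
  diag_mx (\row_i \sum_(w : V) wadj (enum_val i) w)
  - \matrix_(i, j) wadj (enum_val i) (enum_val j).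

Definition mass_mx : 'M[R]_#|V| := diag_mx (\row_i mass G (enum_val i)).

Definition quadf (A : 'M[R]_#|V|) (x : 'cV[R]_#|V|) : R :=
  (x^T *m A *m x) 0 0.

Definition dirichlet_eigenvalue (S : {set V}) : R :=
  minimum [set quadf laplacian x / quadf mass_mx x
          | x in [set x : 'cV[R]_#|V| |
                   (forall v, v \in S -> vcoord x v = 0) /\ x <> 0]]%classic.

Definition set_mass (A : {set V}) : R := \sum_(v in A) mass G v.

Definition eff_resistance (A B : {set V}) : R :=
  (minimum [set quadf laplacian x
           | x in [set x : 'cV[R]_#|V| |
                    (forall v, v \in A -> vcoord x v = 1) /\
                    (forall v, v \in B -> vcoord x v = 0)]]%classic)^-1.

(* The neutral element 0 is harmless: resistances and masses are nonnegative,
   and the range is nonempty when S is proper. *)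
Definition hardy (S : {set V}) : R :=
  \big[Num.max/0]_(A : {set V} | (A != finset.set0) && [disjoint A & S])
    (eff_resistance S A * set_mass A).

Lemma wadjC u v : wadj u v = wadj v u.
Proof.
by rewrite /wadj edge_sym; case: ifP => // e; rewrite (cond_sym e).
Qed.

Lemma quadf_mass x : quadf mass_mx x = \sum_v mass G v * vcoord x v ^+ 2.
Proof.
rewrite /quadf /mass_mx mul_mx_diag mxE.
rewrite (reindex (@enum_rank V)) /=; last first.
  by exists enum_val => i _; rewrite ?enum_valK ?enum_rankK.
by apply: eq_bigr => v _; rewrite !mxE enum_rankK /vcoord expr2 mulrAC mulrC.
Qed.

Lemma quadf_laplacian_kernel x :
  quadf laplacian x =
  \sum_u \sum_v wadj u v * (vcoord x u ^+ 2 - vcoord x u * vcoord x v).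
Proof.
have bij : {on [pred i : 'I_#|V| | true], bijective (@enum_rank V)}.
  by exists enum_val => i _; rewrite ?enum_valK ?enum_rankK.
rewrite /quadf -mulmxA mxE (reindex (@enum_rank V)) //=.
apply: eq_bigr => u _; rewrite /laplacian mulmxBl mul_diag_mx !mxE enum_rankK.
under [RHS]eq_bigr do rewrite mulrBr.
rewrite sumrB mulrBr -/(vcoord x u); congr (_ - _).
  by rewrite -mulr_suml mulrCA -expr2.
rewrite mulr_sumr (reindex (@enum_rank V)) //=.
by apply: eq_bigr => v _; rewrite !mxE !enum_rankK mulrCA.
Qed.

(* Each undirected edge is counted once, by ordering its endpoints. *)
Lemma quadf_laplacian x :
  quadf laplacian x =
  \sum_u \sum_(v | edge G u v && (enum_rank u < enum_rank v)%N)
    cond G u v * (vcoord x u - vcoord x v) ^+ 2.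
Proof.
rewrite quadf_laplacian_kernel.
pose F u v := wadj u v * (vcoord x u ^+ 2 - vcoord x u * vcoord x v).
have Fuu u : F u u = 0 by rewrite /F -expr2 subrr mulr0.
have split_sum : \sum_u \sum_v F u v =
    \sum_u \sum_(v | (enum_rank u < enum_rank v)%N) F u v
  + \sum_u \sum_(v | (enum_rank v < enum_rank u)%N) F u v.
  rewrite -big_split /=; apply: eq_bigr => u _.
  rewrite (bigID (fun v => (enum_rank u < enum_rank v)%N)) /=; congr (_ + _).
  rewrite big_mkcond [RHS]big_mkcond /=; apply: eq_bigr => v _.
  rewrite -leqNgt leq_eqVlt; case: eqP => //= /val_inj/enum_rank_inj ->.
  by rewrite Fuu ltnn.
rewrite [LHS]split_sum.
have -> : \sum_u \sum_(v | (enum_rank v < enum_rank u)%N) F u v =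
          \sum_u \sum_(v | (enum_rank u < enum_rank v)%N) F v u.
  under eq_bigr do rewrite big_mkcond.
  by rewrite exchange_big; apply: eq_bigr => u _; rewrite [RHS]big_mkcond.
rewrite -big_split; apply: eq_bigr => u _ /=.
rewrite -big_split [RHS]big_mkcondl; apply: eq_bigr => v _ /=.
rewrite /F [wadj v u]wadjC -mulrDr /wadj; case: ifP => _; last by rewrite mul0r.
by congr (_ * _); ring.
Qed.

End Graph.

(* Main.v *)
(* Upper bound: if [x] is the equilibrium potential of [A] ([0] on [S], [1] on
   [A]), its Rayleigh quotient is at most [1 / (R(S,A) mu(A))].

   Lower bound (Maz'ya's level-set argument): let [f >= 0] vanish on [S] and
   have values [0 = t_0 < ... < t_k].  Put [d_j = t_(j+1) - t_j], let [w_j] be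
   the sum of [kappa_e |df(e)|] over the edges [e] crossing the gap [j], and
   [r_j = d_j / w_j].  Then the energy of [f] is [sum d_j^2 / r_j].  Replacing
   the values [t_i] by [rho_i = r_0 + ... + r_(i-1)] and truncating shows by
   Cauchy-Schwarz that the level set [{f >= t_i}] has capacity at most
   [1 / rho_i], hence mass at most [H / rho_i].  Summing by layers,
   [sum mu f^2 <= H sum (t_(j+1)^2 - t_j^2) / rho_(j+1)], and a weighted Hardy
   inequality with constant 4 bounds this by [4 H] times the energy. *)

From mathcomp Require Import boolp classical_sets reals.
From mathcomp Require Import topology normedtype derive.
Require Import Defs.
From mathcomp Require Import all_boot all_order all_algebra.
From mathcomp Require Import ring lra zify.

Set Implicit Arguments.
Unset Strict Implicit.
Unset Printing Implicit Defensive.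

Import Order.TTheory GRing.Theory Num.Theory.
Import numFieldNormedType.Exports.

Local Open Scope ring_scope.

(** * One-dimensional inequalities *)

(** The induction step of Hardy's inequality, with [a = rho_k], [b = r_k], [s = t_k], [t = t_(k+1)].
    Over a common denominator the difference is quadratic in [t]; multiplying by the leading
    coefficient completes the square, with remainder [2 a b^3 s^2]. *)
Lemma hardy_step (R : realFieldType) (s t a b : R) : 0 < a -> 0 < b ->
  (t ^+ 2 - s ^+ 2) / (a + b) + t ^+ 2 / (a + b) - s ^+ 2 / a
    <= 4 * ((t - s) ^+ 2 / b).
Proof.
move=> a0 b0; have ab0 : 0 < a + b by lra.
rewrite -subr_ge0.
have -> : 4 * ((t - s) ^+ 2 / b) -
    ((t ^+ 2 - s ^+ 2) / (a + b) + t ^+ 2 / (a + b) - s ^+ 2 / a) =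
  ((2 * a * (2 * a + b)) * t ^+ 2 - 8 * a * (a + b) * t * s +
    (4 * a * (a + b) + 2 * a * b + b ^+ 2) * s ^+ 2) / (a * b * (a + b)).
  by field; rewrite !gt_eqF.
rewrite divr_ge0 //; last by rewrite !mulr_ge0 // ltW.
have c0 : 0 < 2 * a * (2 * a + b) by rewrite mulr_gt0; lra.
rewrite -(pmulr_rge0 _ c0).
have -> : 2 * a * (2 * a + b) *
   ((2 * a * (2 * a + b)) * t ^+ 2 - 8 * a * (a + b) * t * s +
    (4 * a * (a + b) + 2 * a * b + b ^+ 2) * s ^+ 2) =
   (2 * a * (2 * a + b) * t - 4 * a * (a + b) * s) ^+ 2
   + 2 * a * b ^+ 3 * s ^+ 2 by ring.
have b3 : 0 <= b ^+ 3 by rewrite exprn_ge0 // ltW.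
rewrite addr_ge0 ?sqr_ge0 // mulr_ge0 ?sqr_ge0 // mulr_ge0 //.
by rewrite mulr_ge0 // ltW.
Qed.

(* Hardy's inequality with weights [r]: the bound telescopes along the
   discrete analogue of [(F^2 / rho)' = 2 F F' / rho - F^2 / rho^2]. *)
Lemma weighted_hardy (R : realFieldType) (k : nat) (t r : nat -> R) :
  t 0%N = 0 -> (forall j, (j < k)%N -> 0 < r j) ->
  \sum_(j < k) (t j.+1 ^+ 2 - t j ^+ 2) / (\sum_(i < j.+1) r i)
    <= 4 * \sum_(j < k) (t j.+1 - t j) ^+ 2 / r j.
Proof.
move=> t0 r0.
(* The boundary term [t_k^2 / rho_k] strengthens the induction and is dropped at the end, being
   nonnegative. *)
suff H : \sum_(j < k) (t j.+1 ^+ 2 - t j ^+ 2) / (\sum_(i < j.+1) r i)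
    + t k ^+ 2 / (\sum_(i < k) r i)
    <= 4 * \sum_(j < k) (t j.+1 - t j) ^+ 2 / r j.
  apply: le_trans H; rewrite lerDl divr_ge0 ?sqr_ge0 ?sumr_ge0 // => i _.
  exact/ltW/r0.
elim: k r0 => [|k IHk] r0; first by rewrite !big_ord0 t0 expr0n /= mul0r add0r mulr0.
rewrite big_ord_recr [in leRHS]big_ord_recr /= mulrDr.
have {}IHk := IHk (fun j jk => r0 j (ltnW jk)).
have rk := r0 k (ltnSn k).
(* [hardy_step] needs a positive [rho_k], but [rho_0 = 0]. As [t_0 = 0], the first gap only asks for
   [2 x <= 4 x] with [x = t_1^2 / r_0]. *)
case: k r0 rk IHk => [|k] r0 rk IHk.
  rewrite !big_ord_recr !big_ord0 /= t0 expr0n /= !(mulr0, subr0, add0r).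
  have := divr_ge0 (sqr_ge0 (t 1%N)) (ltW rk); lra.
have rho0 : 0 < \sum_(i < k.+1) r i.
  rewrite big_ord_recr /= ltr_wpDl ?sumr_ge0 ?r0 // => i _.
  by apply/ltW/r0; rewrite -addn2 ltn_addr.
rewrite [\sum_(i < k.+2) _]big_ord_recr /=.
have := hardy_step (t k.+1) (t k.+2) rho0 rk.
move: IHk; lra.
Qed.

(** Cauchy-Schwarz, by summing the tangent bounds [h^2 / d >= 2 m h - m^2 d] at [m = X / D], the
    ratio of the totals. *)
Lemma sum_sqr_le (R : realFieldType) (I : finType) (P : pred I) (d h : I -> R) :
  (forall i, P i -> 0 < d i) ->
  (\sum_(i | P i) h i) ^+ 2
    <= (\sum_(i | P i) d i) * \sum_(i | P i) h i ^+ 2 / d i.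
Proof.
move=> d0; set X := \sum_(i | P i) h i; set D := \sum_(i | P i) d i.
have [P0|] := boolP [forall i, ~~ P i].
  by rewrite /X !big_pred0 ?mulr0 ?expr0n //= => i; apply/negbTE/(forallP P0).
rewrite negb_forall => /existsP[i0]; rewrite negbK => Pi0.
have D0 : 0 < D.
  rewrite /D (bigD1 i0) //= ltr_wpDr ?d0 // sumr_ge0 // => i /andP[Pi _].
  exact/ltW/d0.
have : \sum_(i | P i) (2 * (X / D) * h i - (X / D) ^+ 2 * d i)
    <= \sum_(i | P i) h i ^+ 2 / d i.
  apply: ler_sum => i Pi; have di := d0 i Pi; rewrite -subr_ge0.
  have -> : h i ^+ 2 / d i - (2 * (X / D) * h i - (X / D) ^+ 2 * d i) =
     (h i - X / D * d i) ^+ 2 / d i by field; rewrite !gt_eqF.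
  by rewrite divr_ge0 ?sqr_ge0 // ltW.
rewrite sumrB -!mulr_sumr -/X -/D => H.
apply: le_trans (ler_wpM2l (ltW D0) H); rewrite le_eqVlt; apply/orP; left.
by apply/eqP; field; rewrite gt_eqF.
Qed.

(** Gap [j] lies between levels [j] and [j.+1], hence the strict bound on the right only. *)
Definition crosses (j a b : nat) : bool := (minn a b <= j < maxn a b)%N.

(** Squaring removes the sign. The common range [k] lets sums over gaps be exchanged with sums over
    vertex pairs. *)
Lemma sqr_sub_psum (R : comPzRingType) (k a b : nat) (h : nat -> R) :
  (a <= k)%N -> (b <= k)%N ->
  (\sum_(j < a) h j - \sum_(j < b) h j) ^+ 2
    = (\sum_(j < k | crosses j a b) h j) ^+ 2.
Proof.
wlog ab : a b / (a <= b)%N.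
  move=> W; have [/W//|/ltnW/W H] := leqP a b.
  move=> ak bk; rewrite -sqrrN opprB H //; congr (_ ^+ 2).
  by apply: eq_bigl => j; rewrite /crosses minnC maxnC.
move=> ak bk; rewrite -sqrrN opprB; congr (_ ^+ 2).
rewrite -(big_mkord xpredT h) -[\sum_(j < a) _](big_mkord xpredT h).
rewrite (big_cat_nat _ ab) //= addrAC subrr add0r.
rewrite (big_nat_widen _ _ _ _ _ bk) (big_nat_widenl _ _ _ _ _ (leq0n a)).
rewrite big_mkord; apply: eq_bigl => j.
by rewrite /crosses (minn_idPl ab) (maxn_idPr ab) andbC.
Qed.

(** * Dirichlet energy and connectedness *)

Section Energy.
Variables (R : realType) (V : finType) (G : wgraph R V).
Implicit Types (f g : V -> R) (A S : {set V}).

(* Every edge is counted twice, so this is twice the Dirichlet form. *)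
Definition energy f : R := \sum_u \sum_v wadj G u v * (f u - f v) ^+ 2.

Lemma wadj_ge0 u v : 0 <= wadj G u v.
Proof. by rewrite /wadj; case: ifP => // /cond_gt0/ltW. Qed.

Lemma energy_ge0 f : 0 <= energy f.
Proof.
by do 2![apply: sumr_ge0 => ? _]; rewrite mulr_ge0 ?wadj_ge0 ?sqr_ge0.
Qed.

Lemma quadf_laplacian_energy x : quadf (laplacian G) x = energy (vcoord x) / 2.
Proof.
rewrite quadf_laplacian_kernel; set f := vcoord x.
pose F u v := wadj G u v * (f u ^+ 2 - f u * f v).
have E : energy f = \sum_u \sum_v F u v + \sum_u \sum_v F u v.
  rewrite [X in _ = _ + X]exchange_big -big_split; apply: eq_bigr => u _ /=.
  rewrite -big_split; apply: eq_bigr => v _ /=.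
  by rewrite /F (wadjC G v u); ring.
by rewrite E; field.
Qed.

Lemma energy_contraction (phi : R -> R) f :
  (forall a b, `|phi a - phi b| <= `|a - b|) -> energy (phi \o f) <= energy f.
Proof.
move=> H; do 2![apply: ler_sum => ? _]; rewrite ler_wpM2l ?wadj_ge0 //=.
rewrite -[leLHS]real_normK ?num_real // -[leRHS]real_normK ?num_real //.
by rewrite lerXn2r ?nnegrE ?H.
Qed.

Lemma energy_eq0_const f : graph_connected G -> energy f = 0 ->
  forall u v, f u = f v.
Proof.
move=> Gc /eqP E0 u v.
have cl : fingraph.closed (edge G) [pred w | f w == f u].
  move=> a b eab; suff /eqP : (f a - f b) ^+ 2 = 0.
    by rewrite expf_eq0 subr_eq0 /= !inE => /eqP->.
  move: E0; rewrite psumr_eq0 => [/allP/(_ a (mem_index_enum a))/=|i _].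
    rewrite psumr_eq0 => [/allP/(_ b (mem_index_enum b))/=|i _].
      by rewrite /wadj eab mulf_eq0 gt_eqF ?cond_gt0 //= => /eqP.
    by rewrite mulr_ge0 ?wadj_ge0 ?sqr_ge0.
  by apply: sumr_ge0 => j _; rewrite mulr_ge0 ?wadj_ge0 ?sqr_ge0.
have := closed_connect cl (Gc u v).
by rewrite !inE eqxx => /esym/eqP ->.
Qed.

Lemma crossing_edge (P : pred V) u v : graph_connected G -> P u -> ~~ P v ->
  exists a b, [/\ edge G a b, P a & ~~ P b].
Proof.
move=> Gc Pu NPv; apply: contrapT => N.
suff cl : fingraph.closed (edge G) P.
  by have := closed_connect cl (Gc u v); rewrite !unfold_in Pu (negbTE NPv).
move=> a b eab; rewrite !unfold_in; apply/idP/idP => [Pa|Pb]; apply/negPn/negP => NP.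
  by apply: N; exists a, b.
by apply: N; exists b, a; rewrite edge_sym.
Qed.

(** * The level-set argument for a function [t \o rk] with ranked values *)

Section Layers.
Variables (k : nat) (t : nat -> R) (rk : V -> nat) (S : {set V}) (H : R).
Hypotheses (Gc : graph_connected G) (S0 : S != set0).
Hypotheses (t0 : t 0%N = 0) (t_lt : forall j, (j < k)%N -> t j < t j.+1).
Hypotheses (rk_le : forall v, (rk v <= k)%N) (rkS : forall v, v \in S -> rk v = 0%N).
Hypothesis H0 : 0 <= H.
Hypothesis rk_max : exists v, rk v = k.
Hypothesis capH : forall A g, A != set0 -> [disjoint A & S] ->
  (forall v, v \in S -> g v = 0) -> (forall v, v \in A -> g v = 1) ->
  set_mass G A <= H * energy g.

Let d j := t j.+1 - t j.
(** This is [|t (rk u) - t (rk v)|], spread over the gaps it crosses. The weight [w] sums over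
    ordered pairs, so it counts each edge twice, as [energy] does. *)
Let D u v := \sum_(j < k | crosses j (rk u) (rk v)) d j.
Let w j := \sum_u \sum_(v | crosses j (rk u) (rk v)) wadj G u v * D u v.
Let r j := d j / w j.

Let d_gt0 j : (j < k)%N -> 0 < d j.
Proof. by move=> jk; rewrite subr_gt0 t_lt. Qed.

Let D_ge0 u v : 0 <= D u v.
Proof. by apply: sumr_ge0 => j _; apply/ltW/d_gt0. Qed.

(** [S] sits on level 0 and some vertex on level [k], so connectedness puts an edge across every
    gap. *)
Let w_gt0 j : (j < k)%N -> 0 < w j.
Proof.
move=> jk; have [v rkv] := rk_max; have [s sS] := set0Pn _ S0.
have [||a [b [eab ra rb]]] := @crossing_edge (fun x => (rk x <= j)%N) s v Gc.
- by rewrite rkS.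
- by rewrite -ltnNge rkv.
rewrite -ltnNge in rb.
have cab : crosses j (rk a) (rk b) by rewrite /crosses; lia.
have pos u : 0 <= \sum_(x | crosses j (rk u) (rk x)) wadj G u x * D u x.
  by apply: sumr_ge0 => x _; rewrite mulr_ge0 ?wadj_ge0 ?D_ge0.
rewrite /w (bigD1 a) //= ltr_wpDr ?sumr_ge0 // (bigD1 b) //= ltr_wpDr //.
  by apply: sumr_ge0 => x _; rewrite mulr_ge0 ?wadj_ge0 ?D_ge0.
rewrite mulr_gt0 // ?/wadj ?eab ?cond_gt0 // /D (bigD1 (Ordinal jk)) //=.
by rewrite ltr_wpDr ?d_gt0 // sumr_ge0 // => i _; apply/ltW/d_gt0.
Qed.

Let r_gt0 j : (j < k)%N -> 0 < r j.
Proof. by move=> jk; rewrite divr_gt0 ?d_gt0 ?w_gt0. Qed.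

(** Taking [h = d] gives the energy of [t \o rk]; a weight [h ^+ 2 / d] bounds that of a test
    function. *)
Let sum_layers (h : nat -> R) :
  \sum_u \sum_v wadj G u v * (D u v * \sum_(j < k | crosses j (rk u) (rk v)) h j)
  = \sum_(j < k) w j * h j.
Proof.
under [RHS]eq_bigr do rewrite mulr_suml.
rewrite [RHS]exchange_big; apply: eq_bigr => u _ /=.
under [RHS]eq_bigr do rewrite mulr_suml big_mkcond.
rewrite [RHS]exchange_big; apply: eq_bigr => v _ /=.
by rewrite -big_mkcond mulrA [LHS]mulr_sumr.
Qed.

Let t_psum m : t m = \sum_(j < m) d j.
Proof.
by elim: m => [|m IHm]; rewrite ?big_ord0 // big_ord_recr /= -IHm /d addrC subrK.
Qed.

Let energy_layers : energy (t \o rk) = \sum_(j < k) d j ^+ 2 / r j.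
Proof.
transitivity (\sum_(j < k) w j * d j); last first.
  apply: eq_bigr => j _; rewrite /r.
  by field; rewrite !gt_eqF ?w_gt0 ?d_gt0.
rewrite -sum_layers; apply: eq_bigr => u _; apply: eq_bigr => v _ /=.
by rewrite !t_psum (sqr_sub_psum _ (rk_le u) (rk_le v)) expr2.
Qed.

Let rho i := \sum_(j < i) r j.

Let rho_gt0 i : (0 < i <= k)%N -> 0 < rho i.
Proof.
case: i => // i ik; rewrite /rho big_ord_recr /= ltr_wpDl ?r_gt0 // sumr_ge0 //.
by move=> j _; apply/ltW/r_gt0; have := ltn_ord j; lia.
Qed.

(* The test function [rho (min (rk v) i) / rho i] is the potential of the
   series network obtained by shorting each level set. *)
Let level_mass i : (0 < i <= k)%N ->
  set_mass G [set v | (i <= rk v)%N] <= H / rho i.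
Proof.
move=> ik; have rho0 := rho_gt0 ik.
pose h j := if (j < i)%N then r j else 0.
pose g v := (\sum_(j < rk v) h j) / rho i.
have sumh m : (i <= m)%N -> \sum_(j < m) h j = rho i.
  move=> im; rewrite /rho -(big_mkord xpredT r) (big_nat_widen _ _ _ _ _ im).
  by rewrite big_mkord [RHS]big_mkcond.
have gE : energy g <= (rho i)^-1.
  rewrite -[leRHS](_ : rho i / rho i ^+ 2 = _); last first.
    by field; rewrite gt_eqF.
  rewrite ler_pdivlMr ?exprn_gt0 //.
  (* As [r = d / w], each gap below [i] contributes [w * (r ^+ 2 / d) = r], so the Cauchy-Schwarz
     bound on the energy of [rho i * g] adds up to [rho i]. *)
  have E : \sum_(j < k) w j * (h j ^+ 2 / d j) = rho i.
    rewrite /rho -(big_mkord xpredT r) (big_nat_widen _ _ k) 1?(andP ik).2 //.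
    rewrite big_mkord [RHS]big_mkcond; apply: eq_bigr => j _ /=; rewrite /h.
    case: ifP => _; last by rewrite expr0n /= mul0r mulr0.
    by rewrite /r; field; rewrite !gt_eqF ?d_gt0 ?w_gt0.
  rewrite -[leRHS]E -(sum_layers (fun j => h j ^+ 2 / d j)) mulr_suml; apply: ler_sum => u _.
  rewrite mulr_suml; apply: ler_sum => v _.
  rewrite -mulrA ler_wpM2l ?wadj_ge0 // /g -mulrBl expr_div_n divfK.
    rewrite (sqr_sub_psum _ (rk_le u) (rk_le v)).
    by apply: sum_sqr_le => j _; exact: d_gt0.
  by rewrite expf_neq0 // gt_eqF.
apply: le_trans (capH _ _ _ _) _; last exact: (ler_wpM2l H0 gE).
- have [v rkv] := rk_max; apply/set0Pn; exists v.
  by rewrite inE rkv (andP ik).2.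
- apply/pred0P => v /=; rewrite inE; apply/negbTE/negP => /andP[iv /rkS rv].
  by move: ik iv; rewrite rv; lia.
- by move=> v /rkS rv; rewrite /g rv big_ord0 mul0r.
- by move=> v; rewrite inE => iv; rewrite /g sumh // divff // gt_eqF.
Qed.

Lemma layered_hardy :
  \sum_v mass G v * t (rk v) ^+ 2 <= 4 * H * energy (t \o rk).
Proof.
have sqr_psum m : t m ^+ 2 = \sum_(j < m) (t j.+1 ^+ 2 - t j ^+ 2).
  elim: m => [|m IHm]; first by rewrite big_ord0 t0 expr0n.
  by rewrite big_ord_recr /= -IHm addrC subrK.
have t_ge0 j : (j <= k)%N -> 0 <= t j.
  move=> jk; rewrite t_psum sumr_ge0 // => i _; apply/ltW/d_gt0.
  by have := ltn_ord i; lia.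
(* Summation by layers. The set [j < rk v] is level set [j.+1], whose bound [H / rho j.+1] matches
   the denominator in [weighted_hardy]. *)
have -> : \sum_v mass G v * t (rk v) ^+ 2 =
    \sum_(j < k) (t j.+1 ^+ 2 - t j ^+ 2) * set_mass G [set v | (j < rk v)%N].
  under [RHS]eq_bigr do rewrite mulr_sumr big_mkcond.
  rewrite [RHS]exchange_big; apply: eq_bigr => v _ /=.
  rewrite sqr_psum -(big_mkord xpredT (fun j => t j.+1 ^+ 2 - t j ^+ 2)).
  rewrite (big_nat_widen _ _ _ _ _ (rk_le v)) big_mkord mulr_sumr big_mkcond /=.
  by apply: eq_bigr => j _; rewrite inE mulrC.
rewrite energy_layers (mulrC 4) -mulrA.
apply: le_trans (ler_wpM2l H0 (weighted_hardy t0 r_gt0)).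
rewrite mulr_sumr; apply: ler_sum => j _.
have jk := ltn_ord j; rewrite mulrCA ler_wpM2l ?level_mass //.
by rewrite subr_ge0 lerXn2r ?nnegrE ?t_ge0 ?ltW ?t_lt // ltnW.
Qed.

End Layers.

(** Cuts [f] into layers at its distinct values. As [energy] is twice the Dirichlet form, [H] stands
    for half the Hardy quantity. *)
Lemma hardy_of_capacity S (H : R) f :
  graph_connected G -> S != set0 -> 0 <= H ->
  (forall A g, A != set0 -> [disjoint A & S] ->
    (forall v, v \in S -> g v = 0) -> (forall v, v \in A -> g v = 1) ->
    set_mass G A <= H * energy g) ->
  (forall v, v \in S -> f v = 0) ->
  \sum_v mass G v * f v ^+ 2 <= 4 * H * energy f.
Proof.
move=> Gc S0 H0 capH fS.
(* Passing to [|f|] keeps the mass side and does not increase the energy. *)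
wlog f0 : f fS / forall v, 0 <= f v.
  move=> W; have := W (fun v => `|f v|).
  rewrite (eq_bigr (fun v => mass G v * f v ^+ 2)) => [|v _]; last first.
    by rewrite real_normK ?num_real.
  move=> {}W; apply: le_trans (W _ _) _; [|by move=> v; exact: normr_ge0|].
    by move=> v vS; rewrite fS ?normr0.
  rewrite ler_wpM2l ?mulr_ge0 //.
  by apply: (@energy_contraction Num.norm) => a b; exact: ler_dist_dist.
pose s := sort <=%R (undup (codom f)).
have s_lt : sorted <%R s by rewrite sort_lt_sorted undup_uniq.
have s_uniq : uniq s by rewrite sort_uniq undup_uniq.
have mem_s v : f v \in s by rewrite mem_sort mem_undup codom_f.
have s_mem x : x \in s -> exists v, x = f v.
  by rewrite mem_sort mem_undup => /codomP.
have [u uS] := set0Pn _ S0.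
have s_gt0 : (0 < size s)%N.
  by apply: (leq_ltn_trans (leq0n (index (f u) s))); rewrite index_mem.
have s_size : (size s).-1.+1 = size s by rewrite prednK.
pose t := nth 0 s; pose rk v := index (f v) s.
have tE v : t (rk v) = f v by rewrite /t nth_index.
(* The least value is 0 because [f >= 0] vanishes on the nonempty [S]. *)
have t0 : t 0%N = 0.
  have [v tv] := s_mem _ (mem_nth 0 s_gt0).
  apply/le_anti; rewrite {2}/t tv f0 andbT -(fS u uS) -tE.
  by rewrite lt_sorted_leq_nth // inE index_mem.
rewrite (_ : f = t \o rk); last by apply: funext => v; rewrite /= tE.
apply: (@layered_hardy (size s).-1 t rk S H) => //.
- by move=> j jk; rewrite lt_sorted_ltn_nth // inE -s_size ltnS // ltnW.
- by move=> v; rewrite -ltnS s_size index_mem.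
- by move=> v vS; rewrite /rk fS // -t0 index_uniq.
- have [|v tv] := s_mem (t (size s).-1); first by rewrite mem_nth // prednK.
  by exists v; rewrite /rk -tv index_uniq // prednK.
Qed.

End Energy.

(** * Existence of minimisers by compactness *)

Section Attainment.
Variables (R : realType) (V : finType) (G : wgraph R V).
Implicit Types (f g : V -> R) (A B S : {set V}).

Definition vcol f : 'cV[R]_#|V| := \col_i f (enum_val i).

Lemma vcoord_vcol f : vcoord (vcol f) = f.
Proof. by apply: funext => v; rewrite /vcoord mxE enum_rankK. Qed.

Lemma vcoord_tr (y : 'rV[R]_#|V|) v : vcoord y^T v = y 0 (enum_rank v).
Proof. by rewrite /vcoord mxE. Qed.

Lemma sum_continuous (T : topologicalType) (I : finType) (F : I -> T -> R) :
  (forall i, continuous (F i)) -> continuous (fun x => \sum_i F i x).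
Proof. by move=> Fc; apply: continuous_big => [|//]; exact: add_continuous. Qed.

Lemma vcoord_continuous v : continuous (fun y : 'rV[R]_#|V| => vcoord y^T v).
Proof.
rewrite (_ : (fun _ => _) = fun y : 'rV[R]_#|V| => y 0 (enum_rank v)).
  exact: coord_continuous.
by apply: funext => y; rewrite vcoord_tr.
Qed.

Lemma diff_continuous (T : topologicalType) (f g : T -> R) :
  continuous f -> continuous g -> continuous (fun x => f x - g x).
Proof. by move=> fc gc x; apply: (@cvgB _ R^o); [exact: fc|exact: gc]. Qed.

Lemma weighted_sqr_continuous (T : topologicalType) (c : R) (f : T -> R) :
  continuous f -> continuous (fun x => c * f x ^+ 2).
Proof.
move=> fc x; apply: (@cvgM _ _ _ _ (fun=> c) (fun x => f x ^+ 2)).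
  exact: cvg_cst.
by apply: (@cvgM _ _ _ _ f f); exact: fc.
Qed.

Lemma energy_continuous :
  continuous (fun y : 'rV[R]_#|V| => energy G (vcoord y^T)).
Proof.
apply: sum_continuous => u; apply: sum_continuous => v.
by apply/weighted_sqr_continuous/diff_continuous; exact: vcoord_continuous.
Qed.

Lemma mass_continuous :
  continuous (fun y : 'rV[R]_#|V| => \sum_v mass G v * vcoord y^T v ^+ 2).
Proof.
apply: sum_continuous => v; apply: weighted_sqr_continuous.
exact: vcoord_continuous.
Qed.

(** Extreme value theorem on a compact box. [C] will be the whole space for capacities and the unit
    mass sphere for the Rayleigh quotient. *)
Lemma energy_min_on_box (lo hi : V -> R) (C : set 'rV[R]_#|V|) (y0 : 'rV[R]_#|V|) :
  topology_structure.closed C -> C y0 -> (forall v, lo v <= vcoord y0^T v <= hi v) ->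
  exists y, [/\ C y, forall v, lo v <= vcoord y^T v <= hi v &
    forall z, C z -> (forall v, lo v <= vcoord z^T v <= hi v) ->
      energy G (vcoord y^T) <= energy G (vcoord z^T)].
Proof.
move=> clC Cy0 y0b.
pose seg (i : 'I_#|V|) := `[lo (enum_val i), hi (enum_val i)]%classic.
pose K := [set y : 'rV[R]_#|V| | forall i, seg i (y ord0 i)]%classic.
have Kc : compact K.
  by apply: (@rV_compact _ _ seg) => i; exact: segment_compact.
have KP y : K y <-> forall v, lo v <= vcoord y^T v <= hi v.
  split=> [Ky v|yb i]; rewrite /seg /= ?in_itv /=.
    by have := Ky (enum_rank v); rewrite /seg /= in_itv /= enum_rankK vcoord_tr.
  by have := yb (enum_val i); rewrite vcoord_tr enum_valK.
have [||y /set_mem[/KP yb Cy] ymin] := @compact_EVT_min _ R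
    (fun y : 'rV[R]_#|V| => energy G (vcoord y^T)) (K `&` C)%classic _
    (compact_closedI Kc clC).
- by exists y0; split=> //; apply/KP.
- by apply: continuous_subspaceT; exact: energy_continuous.
exists y; split=> // z Cz zb; apply: ymin; apply/mem_set; split=> //; exact/KP.
Qed.

Lemma clamp_contraction (a b : R) :
  `|Num.max 0 (Num.min a 1) - Num.max 0 (Num.min b 1)| <= `|a - b|.
Proof.
have := ler_norm (a - b); have := ler_norm (b - a); rewrite (distrC b).
have := normr_ge0 (a - b); set N := `|a - b| => N0 ba ab; rewrite ler_norml.
case: (leP a 1) => ?; case: (leP b 1) => ?; rewrite ?(max_r ler01);
  [case: (leP 0 a); case: (leP 0 b) | case: (leP 0 a) | case: (leP 0 b) | ];
  by move=> *; apply/andP; split; lra.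
Qed.

(* Clamping to [0, 1] preserves the boundary conditions and decreases the
   energy, which makes the minimisation problem compact. *)
Lemma capacity_attained A B : [disjoint A & B] ->
  exists x : 'cV[R]_#|V|, [/\ forall v, v \in A -> vcoord x v = 1,
    forall v, v \in B -> vcoord x v = 0 &
    forall g, (forall v, v \in A -> g v = 1) -> (forall v, v \in B -> g v = 0) ->
      quadf (laplacian G) x <= energy G g / 2].
Proof.
(* The box is [{1}] on [A], [{0}] on [B] and [[0, 1]] elsewhere, so it encodes the boundary
   conditions. *)
move=> AB; pose lo v : R := (v \in A)%:R; pose hi v : R := (v \notin B)%:R.
have clT : topology_structure.closed [set: 'rV[R]_#|V|]%classic by exact: closedT.
have lohi v : lo v <= hi v.
  rewrite /lo /hi; have [vA|_] := boolP (v \in A); last exact: ler0n.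
  by rewrite (disjointFr AB vA).
have lob : forall v, lo v <= vcoord ((vcol lo)^T)^T v <= hi v.
  by move=> v; rewrite trmxK vcoord_vcol lexx lohi.
have [y [_ yb ymin]] := @energy_min_on_box lo hi _ _ clT I lob.
exists y^T; split=> [v vA|v vB|g gA gB].
- have := yb v; rewrite /lo /hi vA (disjointFr AB vA) /=.
  by move=> /andP[? ?]; apply/le_anti/andP.
- have := yb v; rewrite /lo /hi vB (disjointFl AB vB) /=.
  by move=> /andP[? ?]; apply/le_anti/andP.
rewrite quadf_laplacian_energy ler_pM2r ?invr_gt0 //.
pose c (a : R) := Num.max 0 (Num.min a 1).
apply: le_trans (@energy_contraction _ _ _ c g clamp_contraction).
have := ymin (vcol (c \o g))^T I; rewrite trmxK vcoord_vcol; apply => v /=.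
rewrite /lo /hi /c; have [vA|vA] := boolP (v \in A).
  by rewrite gA // (disjointFr AB vA) /= minxx max_r ?lexx ?ler01.
have [vB|vB] := boolP (v \in B).
  by rewrite gB //= min_l ?ler01 // maxxx lexx.
by rewrite le_max lexx /= ge_max ler01 ge_min lexx orbT.
Qed.

Lemma mass_gt0_of_neq0 f v : f v != 0 -> 0 < \sum_u mass G u * f u ^+ 2.
Proof.
move=> fv; rewrite (bigD1 v) //= ltr_wpDr //.
  by apply: sumr_ge0 => u _; rewrite mulr_ge0 ?sqr_ge0 // ltW // mass_gt0.
by rewrite mulr_gt0 ?mass_gt0 // exprn_even_gt0.
Qed.

Lemma neq0_vcoord (x : 'cV[R]_#|V|) : x <> 0 -> exists v, vcoord x v != 0.
Proof.
move=> x0; apply: contrapT => N; apply: x0; apply/colP => i; rewrite mxE.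
apply/eqP/negPn/negP => xi; apply: N; exists (enum_val i).
by rewrite /vcoord enum_valK.
Qed.

(** The quotient is invariant under scaling, so it suffices to minimise the energy at mass 1, a
    closed condition that bounds every coordinate. *)
Lemma rayleigh_attained S : S \proper [set: V] ->
  exists x : 'cV[R]_#|V|, [/\ forall v, v \in S -> vcoord x v = 0, x <> 0 &
    forall y : 'cV[R]_#|V|, (forall v, v \in S -> vcoord y v = 0) -> y <> 0 ->
      quadf (laplacian G) x / quadf (mass_mx G) x
        <= quadf (laplacian G) y / quadf (mass_mx G) y].
Proof.
case/properP => _ [v0 _ v0S].
pose M f := \sum_u mass G u * f u ^+ 2.
(* Mass 1 forces [f v ^+ 2 <= (mass G v)^-1 <= c]; the summand 1 gives [c <= c ^+ 2], hence
   [|f v| <= c]. *)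
pose c : R := 1 + \sum_v (mass G v)^-1.
have minv_ge0 v : 0 <= (mass G v)^-1 by rewrite invr_ge0 ltW ?mass_gt0.
have c1 : 1 <= c by rewrite lerDl sumr_ge0.
have c0 : 0 <= c by exact: le_trans c1.
pose lo v := if v \in S then 0 else - c; pose hi v := if v \in S then 0 else c.
have box f : (forall v, v \in S -> f v = 0) -> M f = 1 ->
    forall v, lo v <= f v <= hi v.
  move=> fS Mf v; rewrite /lo /hi; case: ifP => [/fS->|_]; first by rewrite lexx.
  rewrite -ler_norml -(@ler_pXn2r _ 2) ?nnegrE //.
  rewrite real_normK ?num_real //.
  have fv : mass G v * f v ^+ 2 <= 1.
    rewrite -Mf /M (bigD1 v) //= lerDl sumr_ge0 // => u _.
    by rewrite mulr_ge0 ?sqr_ge0 // ltW // mass_gt0.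
  have {}fv : f v ^+ 2 <= (mass G v)^-1.
    by rewrite -ler_pdivlMl ?mulr1 ?mass_gt0 // in fv.
  apply: le_trans fv _; apply: (@le_trans _ _ c).
    by rewrite /c (bigD1 v) //= addrCA lerDl addr_ge0 ?sumr_ge0.
  by rewrite expr2 ler_peMl.
pose nrm f v := f v / Num.sqrt (M f).
have nrmS f v : f v = 0 -> nrm f v = 0.
  by move=> fv; rewrite /nrm fv mul0r.
have Mnrm f : 0 < M f -> M (nrm f) = 1.
  move=> M0; rewrite /M -(divff (lt0r_neq0 M0)) {2}/M mulr_suml.
  apply: eq_bigr => v _; rewrite /nrm expr_div_n sqr_sqrtr ?mulrA //; exact: ltW.
have Enrm f : 0 < M f -> energy G (nrm f) = energy G f / M f.
  move=> M0; rewrite /energy mulr_suml; apply: eq_bigr => u _.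
  rewrite mulr_suml; apply: eq_bigr => v _.
  by rewrite /nrm -mulrBl expr_div_n sqr_sqrtr ?mulrA // ltW.
pose C := [set y : 'rV[R]_#|V| | M (vcoord y^T) = 1]%classic.
have clC : topology_structure.closed C.
  have /continuous_closedP clM := mass_continuous.
  have clM1 := clM _ (@closed_eq R 1); exact clM1.
(* The normalised indicator of a vertex outside [S] is admissible. *)
pose f0 v : R := (v == v0)%:R.
have f0S v : v \in S -> f0 v = 0.
  by move=> vS; rewrite /f0; case: eqP => // E; rewrite -E vS in v0S.
have Mf0 : 0 < M f0 by apply: (@mass_gt0_of_neq0 _ v0); rewrite /f0 eqxx oner_neq0.
have Cf0 : C (vcol (nrm f0))^T by rewrite /C /= trmxK vcoord_vcol Mnrm.
have [|y [Cy yb ymin]] := @energy_min_on_box lo hi C _ clC Cf0.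
  by rewrite trmxK vcoord_vcol; apply: box; [move=> v /f0S/nrmS|exact: Mnrm].
exists y^T; split.
- move=> v vS; have := yb v; rewrite /lo /hi vS => /andP[? ?].
  by apply/le_anti/andP.
- move=> y0; move: Cy; rewrite /C /= y0 /M big1 => [/esym/eqP|v _].
    by rewrite oner_eq0.
  by rewrite /vcoord mxE expr0n mulr0.
move=> z zS /neq0_vcoord[v zv].
have Mz : 0 < M (vcoord z) by exact: mass_gt0_of_neq0 zv.
rewrite !quadf_mass !quadf_laplacian_energy -/(M _) -/(M (vcoord z)).
rewrite [M (vcoord y^T)]Cy divr1 mulrAC ler_pM2r ?invr_gt0 // -Enrm //.
have := ymin (vcol (nrm (vcoord z)))^T; rewrite /C /= trmxK vcoord_vcol; apply.
  exact: Mnrm.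
by apply: box; [move=> u /zS/nrmS|exact: Mnrm].
Qed.

End Attainment.

(** * The two eigenvalue bounds *)

Theorem theorem4 (R : realType) (V : finType) (G : wgraph R V) (S : {set V})
  (G_connected : graph_connected G)
  (S_nonempty : S != set0) (S_proper : S \proper [set: V]) :
  1 / (4 * hardy G S) <= dirichlet_eigenvalue G S <= 1 / hardy G S.
Proof.
set h := hardy G S.
pose Lq := quadf (laplacian G); pose Mq := quadf (mass_mx G).
(* [eff_resistance G S A] prescribes 1 on [S] and 0 on [A]; the reflection [1 - g] turns its
   potentials into functions vanishing on [S]. *)
have compl (g : V -> R) : energy G (fun v => 1 - g v) = energy G g.
  by do 2![apply: eq_bigr => ? _]; congr (_ * _); ring.
have capP A : A != set0 -> [disjoint A & S] -> exists x, [/\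
    (forall v, v \in S -> vcoord x v = 0), (forall v, v \in A -> vcoord x v = 1),
    0 < Lq x, eff_resistance G S A = (Lq x)^-1 &
    forall g, (forall v, v \in S -> g v = 0) -> (forall v, v \in A -> g v = 1) ->
      Lq x <= energy G g / 2].
  move=> A0 AS; have SA : [disjoint S & A] by rewrite disjoint_sym.
  have [x [xS xA xmin]] := capacity_attained G SA.
  exists (vcol (fun v => 1 - vcoord x v)).
  have LE : Lq (vcol (fun v => 1 - vcoord x v)) = Lq x.
    by rewrite /Lq !quadf_laplacian_energy vcoord_vcol compl.
  rewrite vcoord_vcol LE; split=> [v /xS->|v /xA->|||g gS gA].
  - by rewrite subrr.
  - by rewrite subr0.
  - rewrite /Lq quadf_laplacian_energy divr_gt0 // lt_def energy_ge0 andbT.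
    have [s sS] := set0Pn _ S_nonempty; have [a aA] := set0Pn _ A0.
    apply/eqP => /(energy_eq0_const G_connected)/(_ s a).
    by rewrite xS // xA // => /eqP; rewrite oner_eq0.
  - congr _^-1; apply: minimumE; first by exists x.
    by move=> _ [y [yS yA] <-]; rewrite [leRHS]quadf_laplacian_energy xmin.
  - rewrite -compl; apply: xmin => [v /gS->|v /gA->]; first by rewrite subr0.
    by rewrite subrr.
have mass_pos A : A != set0 -> 0 < set_mass G A.
  case/set0Pn=> a aA; rewrite /set_mass (bigD1 a) //= ltr_wpDr ?mass_gt0 //.
  by apply: sumr_ge0 => v _; rewrite ltW ?mass_gt0.
pose F A := eff_resistance G S A * set_mass G A.
have F_gt0 A : (A != set0) && [disjoint A & S] -> 0 < F A.
  case/andP=> A0 AS; have [x [_ _ x0 xR _]] := capP _ A0 AS.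
  by rewrite /F xR mulr_gt0 ?invr_gt0 ?mass_pos.
have PSc : (~: S != set0) && [disjoint ~: S & S].
  rewrite disjoints_subset subxx andbT; case/properP: S_proper => _ [v _ vS].
  by apply/set0Pn; exists v; rewrite inE.
(* Since [F] is nonnegative on a nonempty range, the default 0 of the maximum does no harm and the
   maximum is attained. *)
have [A0 PA0 hA0] : {A0 | (A0 != set0) && [disjoint A0 & S] & h = F A0}.
  by have := eq_bigmax (~: S) _ F PSc (fun A PA => ltW (F_gt0 A PA)).
have h_ge A : A != set0 -> [disjoint A & S] -> F A <= h.
  by move=> A1 A2; apply: le_bigmax_cond; rewrite A1.
have h_gt0 : 0 < h by rewrite hA0 F_gt0.
have [x [xS x0 xmin]] := rayleigh_attained G S_proper.
have -> : dirichlet_eigenvalue G S = Lq x / Mq x.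
  apply: minimumE; first by exists x.
  by move=> _ [y [yS y0] <-]; exact: xmin.
have Mq_gt0 y : y <> 0 -> 0 < Mq y.
  by case/neq0_vcoord => v yv; rewrite /Mq quadf_mass; exact: mass_gt0_of_neq0 yv.
apply/andP; split.
  rewrite ler_pdivrMr ?mulr_gt0 // mulrAC ler_pdivlMr ?Mq_gt0 // mul1r.
  rewrite /Lq /Mq quadf_mass quadf_laplacian_energy.
  (* Doubling in [energy] is compensated by using [h / 2] as the capacity constant. *)
  have -> : energy G (vcoord x) / 2 * (4 * h) = 4 * (h / 2) * energy G (vcoord x).
    by field.
  apply: (hardy_of_capacity G_connected S_nonempty _ _ xS).
    by rewrite divr_ge0 ?ltW.
  move=> A g A1 AS gS gA; have [y [_ _ y0 yR ymin]] := capP _ A1 AS.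
  have := h_ge _ A1 AS; rewrite /F yR ler_pdivrMl // => /le_trans; apply.
  rewrite mulrC -mulrA (mulrC 2^-1) ler_pM2l //; exact: ymin.
case/andP: PA0 => A1 AS; have [y [yS yA Ly0 yR _]] := capP _ A1 AS.
have y0 : y <> 0.
  have [a aA] := set0Pn _ A1 => y0; have := yA a aA.
  by rewrite y0 /vcoord mxE => /esym/eqP; rewrite oner_eq0.
apply: le_trans (xmin y yS y0) _.
rewrite hA0 /F yR div1r invfM invrK ler_pM2l // lef_pV2 ?posrE ?mass_pos ?Mq_gt0 //.
(* The mass form of [y] is at least its part over [A0], where [y = 1]. *)
rewrite /Mq quadf_mass [leRHS](bigID (mem A0)) /= /set_mass.
rewrite (eq_bigr (fun v => mass G v * vcoord y v ^+ 2)) => [|v vA]; last first.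
  by rewrite yA // expr1n mulr1.
by rewrite lerDl sumr_ge0 // => v _; rewrite mulr_ge0 ?sqr_ge0 // ltW ?mass_gt0.
Qed.
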